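(* Let $X$ be a diffeological space and let $A$ be a quasi-sheaf (in particular, for instance, a sheaf) of abelian groups on $X$. Then, for $\mathcal{C}$ a covering generating family of $X$, the natural homomorphism $$h=\gamma_{\mathcal{C}}\circ\beta_{\mathcal{C}}\circ\alpha_{\mathcal{C}}:\Sigma A(X)\longrightarrow\check H^0(X;A)$$ is an isomorphism.
   Context: Diffeology. A domain is an open subset of some $\mathbb{R}^n$; a diffeology on a set $X$ is a set of parametrizations (maps from domains to $X$), called plots, whose images cover $X$, closed under precomposition with smooth maps between domains and under suprema of compatible families (families of plots on $n$-domains agreeing on overlaps). A covering generating family of $X$ is a set $\mathcal{C}$ of plots whose images cover $X$ and such that every plot is the supremum of a compatible family of parametrizations in $\lfloor\mathcal{C}\rfloor=\{P\circ F: P\in\mathcal{C},\ F\text{ a smooth map between domains}\}$. A morphism of plots $Q\xrightarrow{F}P$ is a smooth map $F:\mathrm{dom}(Q)\to\mathrm{dom}(P)$ with $P\circ F=Q$. Sheaves. A presheaf $A$ on $X$ is a contravariant functor from plots in $X$ and their morphisms to abelian groups; $F^*:A(P)\to A(Q)$ is induced by $Q\xrightarrow{F}P$. It is a sheaf if, for every plot $P$ that is the supremum of a compatible family $\{P_i\}$, $A(P)$ is the equalizer of $\prod_iA(P_i)\rightrightarrows\prod_{i,j}A(P|_{\mathrm{dom}P_i\cap\mathrm{dom}P_j})$. $\Sigma A(X)$ (sections) is the limit of $A$ over all plots; $\Sigma A(\mathcal{C})$ is the limit of the restriction of $A$ to $\lfloor\mathcal{C}\rfloor$, and $\alpha_{\mathcal{C}}:\Sigma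 A(X)\to\Sigma A(\mathcal{C})$ is the canonical restriction map. $A$ is a quasi-sheaf if $\alpha_{\mathcal{C}}$ is an isomorphism for every covering generating family $\mathcal{C}$ of $X$ (every sheaf is a quasi-sheaf). Čech cohomology. Simplices on $\mathcal{C}$: a $0$-simplex is an element $P_0\in\mathcal{C}$ (nerve plot $P_0$); a $1$-simplex is a diagram $P_0\xleftarrow{F_1}Q\xrightarrow{F_0}P_1$ of morphisms of plots with $P_0,P_1\in\mathcal{C}$ (nerve plot $Q$). Put $C^0(X,\mathcal{C},A)=\prod_{P\in\mathcal{C}}A(P)$, $C^1(X,\mathcal{C},A)=\prod_{1\text{-simplices}}A(Q)$, and $\delta^0(c)(P_0\xleftarrow{F_1}Q\xrightarrow{F_0}P_1)=F_0^*c(P_1)-F_1^*c(P_0)$. Then $H^0(X,\mathcal{C};A)=\ker\delta^0$. The map $\beta_{\mathcal{C}}:\Sigma A(\mathcal{C})\to H^0(X,\mathcal{C};A)$ is the natural isomorphism $\sigma\mapsto(\sigma(P))_{P\in\mathcal{C}}$. A refinement $\mathcal{C}'=\{P'_\beta\}_{\beta\in J}$ of $\mathcal{C}=\{P_\alpha\}_{\alpha\in I}$ is a covering generating family with a map $\lambda:J\to I$ and morphisms $P'_\beta\xrightarrow{f_\beta}P_{\lambda(\beta)}$; it induces $j(\mathcal{C}',\mathcal{C}):H^0(X,\mathcal{C};A)\to H^0(X,\mathcal{C}';A)$, $\lambda^*(c)(P'_\beta)=f_\beta^*c(P_{\lambda(\beta)})$, independent of the choice of $(\lambda,f)$. $\check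 H^0(X;A)=\varinjlim_{\mathcal{C}}H^0(X,\mathcal{C};A)$ over covering generating families and refinements, and $\gamma_{\mathcal{C}}:H^0(X,\mathcal{C};A)\to\check H^0(X;A)$ is the canonical map to the colimit. *)

(* Defs.v *)
From HB Require Import structures.
From mathcomp Require Import all_boot all_order all_algebra.
From mathcomp Require Import all_classical reals interval_inference topology.
From mathcomp Require Import normedtype landau derive.

Set Implicit Arguments.
Unset Strict Implicit.
Unset Printing Implicit Defensive.

Import Order.TTheory GRing.Theory Num.Theory numFieldNormedType.Exports.

Local Open Scope classical_set_scope.
Local Open Scope ring_scope.
Local Open Scope quotient_scope.

Section Ck.
Context {R : realType}.
Implicit Types V W : normedModType R.

(* In finite dimension, the Frechet derivative of [f] is of class C^k iff all
   the maps [x |-> 'D_v f x] are. For open [U] the predicate only depends on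
   the values of [f] on [U]. *)
Fixpoint Ck_on (k : nat) {V W} (U : set V) (f : V -> W) : Prop :=
  if k is k'.+1 then
    (forall x, U x -> differentiable f x) /\
    (forall v, Ck_on k' U (fun x => 'D_v f x))
  else forall x, U x -> {for x, continuous f}.

Definition smooth_on {V W} (U : set V) (f : V -> W) : Prop :=
  forall k, Ck_on k U f.

Lemma near_eq_differentiable V W (f g : V -> W) (x : V) :
  {near x, f =1 g} -> differentiable f x -> differentiable g x.
Proof.
move=> fg df; have fgx : f x = g x := nbhs_singleton fg.
have [cdf fE] := (diff_locallyP _ _).1 df.
have gE : g \o shift x = cst (g x) + 'd f x +o_ 0 id.
  apply/eqaddoP => _/posnumP[e].
  have /eqaddoP/(_ e%:num (gt0 _)) h := fE.
  have fg0 : \forall y \near 0, f (y + x) = g (y + x).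
    by move: fg; rewrite [X in X -> _](near_shift 0) subr0.
  move: h; apply: filterS2 fg0 => y /= E.
  by rewrite !fctE /= E fgx.
have E := diff_unique cdf gE.
by apply/diff_locallyP; rewrite E.
Qed.

Lemma eq_Ck_on k V W (U : set V) (f g : V -> W) : open U ->
  (forall x, U x -> f x = g x) -> Ck_on k U f -> Ck_on k U g.
Proof.
move=> oU; elim: k f g => [|k IH] f g fg /=; have nfg x : U x -> {near x, f =1 g}.
- by move=> Ux; apply: filterS (open_nbhs_nbhs (conj oU Ux)) => y /fg.
- move=> Cf x Ux; rewrite /prop_for /continuous_at -(fg _ Ux).
  by apply: cvg_trans (Cf _ Ux); apply/near_eq_cvg/filterS/(nfg _ Ux) => y /esym.
- by move=> Ux; apply: filterS (open_nbhs_nbhs (conj oU Ux)) => y /fg.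
move=> [df Cf]; split=> [x Ux|v].
  exact: near_eq_differentiable (nfg _ Ux) (df _ Ux).
by apply: IH (Cf v) => x Ux; apply: near_eq_derive; apply: nfg.
Qed.

Lemma Ck_onS k V W (U : set V) (f : V -> W) : Ck_on k.+1 U f -> Ck_on k U f.
Proof.
elim: k f => [|k IH] f [df Cf]; first by move=> x /df /differentiable_continuous.
by split=> // v; apply: IH.
Qed.

Lemma Ck_on_cst k V W (U : set V) (a : W) : Ck_on k U (cst a).
Proof.
elim: k a => [|k IH] a /=; first by move=> x _; apply: cst_continuous.
split=> [x _|v]; first exact: differentiable_cst.
have -> : (fun x => 'D_v (cst a) x) = cst (0 : W) :> (V -> W).
  by apply/funext => x; rewrite derive_cst.
exact: IH.
Qed.

Lemma Ck_on_add k V W (U : set V) (f g : V -> W) : open U ->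
  Ck_on k U f -> Ck_on k U g -> Ck_on k U (f + g).
Proof.
move=> oU; elim: k f g => [|k IH] f g /=.
  by move=> Cf Cg x Ux; apply: continuousD; [apply: Cf|apply: Cg].
move=> [df Cf] [dg Cg]; split=> [x Ux|v].
  by apply: differentiableD; [apply: df|apply: dg].
apply: (eq_Ck_on oU _ (IH _ _ (Cf v) (Cg v))) => x Ux.
by rewrite deriveD //; apply: diff_derivable; [apply: df|apply: dg].
Qed.

Lemma Ck_on_sum k V W (U : set V) n (f : 'I_n -> V -> W) : open U ->
  (forall i, Ck_on k U (f i)) -> Ck_on k U (\sum_(i < n) f i).
Proof.
move=> oU Cf; elim/big_ind: _ => //; first exact: (Ck_on_cst k U 0).
by move=> ? ?; apply: Ck_on_add.
Qed.

Lemma diff_scale V W (a : V -> R^o) (b : V -> W) x :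
  differentiable a x -> differentiable b x ->
  differentiable (fun y => a y *: b y) x /\
  forall v, 'd (fun y => a y *: b y) x v = a x *: 'd b x v + 'd a x v *: b x.
Proof.
move=> da db.
have bl : bilinear_for
   (GRing.Scale.Law.clone _ _ *:%R _) (GRing.Scale.Law.clone _ _ *:%R _)
   (fun (r : R^o) (w : W) => r *: w).
  split=> [w|r] c u v /=; first by rewrite scalerDl scalerA.
  by rewrite scalerDr !scalerA mulrC.
pose sM := bilinear_isBilinear.Build R _ _ _ _ _ _ bl.
pose s : {bilinear R^o -> W -> W} := HB.pack (fun (r : R^o) (w : W) => r *: w) sM.
have sc : continuous (fun p : R^o * W => s p.1 p.2) by apply: scale_continuous.
have dp : differentiable (fun y => (a y, b y)) x by apply: differentiable_pair.
have ds : differentiable (fun p : R^o * W => s p.1 p.2) (a x, b x).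
  exact: differentiable_bilin.
split; first exact: (differentiable_comp dp ds).
move=> v; have /(congr1 (@^~ v)) E := diff_comp dp ds.
have {}E : 'd (fun y => a y *: b y) x v =
    'd (fun p => s p.1 p.2) (a x, b x) ('d (fun y => (a y, b y)) x v) by [].
by rewrite E diff_pair // (diff_bilin _ sc).
Qed.

Lemma Ck_on_scale k V W (U : set V) (a : V -> R^o) (b : V -> W) : open U ->
  Ck_on k U a -> Ck_on k U b -> Ck_on k U (fun x => a x *: b x).
Proof.
move=> oU; elim: k a b => [|k IH] a b Ca Cb.
  by move=> x Ux; apply: continuousZ; [apply: Ca|apply: Cb].
have [[da Ca'] [db Cb']] := (Ca, Cb); split=> [x Ux|v].
  exact: (diff_scale (da _ Ux) (db _ Ux)).1.
apply: (eq_Ck_on oU _ (Ck_on_add oU (IH _ _ (Ck_onS Ca) (Cb' v))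
                                    (IH _ _ (Ca' v) (Ck_onS Cb)))) => x Ux.
have [d dE] := diff_scale (da _ Ux) (db _ Ux).
by rewrite [RHS]deriveE // dE /= !fctE !deriveE //; [apply: da|apply: db].
Qed.

Lemma Ck_on_coord k V n (U : set V) (f : V -> 'rV[R]_n) i : open U ->
  Ck_on k U f -> Ck_on k U (fun x => f x ord0 i : R^o).
Proof.
move=> oU; elim: k f => [|k IH] f /=.
  move=> Cf x /Cf Cfx.
  exact: (continuous_comp Cfx (@coord_continuous _ _ _ ord0 i (f x))).
move=> [df Cf]; split=> [x /df dfx|v].
  exact: (differentiable_comp dfx (differentiable_coord (f x) ord0 i)).
apply: (eq_Ck_on oU _ (IH _ (Cf v))) => x /df dfx.
by rewrite derive_mx ?mxE//; apply: diff_derivable.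
Qed.

Lemma Ck_on_comp k V n W (U : set V) (T : set 'rV[R]_n)
    (f : V -> 'rV[R]_n) (g : 'rV[R]_n -> W) : open U ->
  (forall x, U x -> T (f x)) ->
  Ck_on k U f -> Ck_on k T g -> Ck_on k U (g \o f).
Proof.
move=> oU UT; elim: k g => [|k IH] g Cf Cg.
  by move=> x Ux; apply: continuous_comp; [apply: Cf|apply/Cg/UT].
have [[df Cf'] [dg Cg']] := (Cf, Cg).
split=> [x Ux|v].
  by apply: differentiable_comp; [apply: df|apply/dg/UT].
pose h := \sum_(i < n) (fun x => ('D_v f x) ord0 i *: 'D_('e_i) g (f x)).
apply: (@eq_Ck_on _ _ _ _ h) => //.
  move=> x Ux; have dfx := df _ Ux; have dgx := dg _ (UT _ Ux).
  rewrite [RHS]deriveE; last exact: differentiable_comp.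
  rewrite diff_comp //= -(deriveE v dfx) [X in _ = _ X]row_sum_delta linear_sum.
  rewrite /h fct_sumE; apply: eq_bigr => i _.
  by rewrite linearZ /= -deriveE.
apply: Ck_on_sum => // i; apply: Ck_on_scale => //.
  exact: (Ck_on_coord i oU (Cf' v)).
exact: (IH (fun y => 'D_('e_i) g y) (Ck_onS Cf) (Cg' _)).
Qed.

Lemma smooth_on_comp V n W (U : set V) (T : set 'rV[R]_n)
    (f : V -> 'rV[R]_n) (g : 'rV[R]_n -> W) : open U ->
  (forall x, U x -> T (f x)) ->
  smooth_on U f -> smooth_on T g -> smooth_on U (g \o f).
Proof. by move=> oU UT Cf Cg k; apply: (Ck_on_comp oU UT). Qed.

Lemma smooth_on_id V (U : set V) : smooth_on U id.
Proof.
case=> [|k]; first by move=> x _; exact: cvg_id.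
split=> // v; have -> : (fun x : V => 'D_v id x) = cst v.
  by apply/funext => x; rewrite derive_id.
exact: Ck_on_cst.
Qed.
End Ck.

Section Domains.
Context {R : realType}.

(* A domain, possibly empty, in R^n; maps defined on a domain [U] are functions
   on the subtype [U] (through the coercion [set_type]), so that [=] on them
   does not involve junk values outside [U]. *)
Record domain (n : nat) := Domain {
  domain_set :> set 'rV[R]_n ;
  domain_open : open domain_set }.

Arguments domain_open {n} d : rename.

(* [U] being open, asking for an extension [f] that is smooth on [U] only says
   that [F] is smooth: [f] is unconstrained outside [U]. *)
Definition smooth n m (U : domain n) (V : domain m) (F : U -> V) : Prop :=
  exists2 f : 'rV[R]_n -> 'rV[R]_m,
    smooth_on U f & forall x : U, f (val x) = val (F x).

Record smooth_map n m (U : domain n) (V : domain m) := SmoothMap {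
  smooth_fun :> U -> V ;
  smooth_funP : smooth smooth_fun }.

Lemma smooth_id n (U : domain n) : smooth (@id U).
Proof. by exists id => //; apply: smooth_on_id. Qed.

Lemma smooth_comp n m p (U : domain n) (V : domain m) (W : domain p)
  (F : U -> V) (G : V -> W) : smooth F -> smooth G -> smooth (G \o F).
Proof.
move=> [f sf fE] [g sg gE]; exists (g \o f); last by move=> x /=; rewrite fE gE.
apply: (smooth_on_comp (T := V)) => //; first exact: domain_open.
move=> x Ux; have := fE (exist _ x (mem_set Ux)); rewrite /= => ->.
exact: set_mem (valP _).
Qed.

Definition smap_id n (U : domain n) := SmoothMap (smooth_id U).

Definition smap_comp n m p (U : domain n) (V : domain m) (W : domain p)
  (G : smooth_map V W) (F : smooth_map U V) : smooth_map U W :=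
  SmoothMap (smooth_comp (smooth_funP F) (smooth_funP G)).

Lemma smooth_incl n (U V : domain n) (UV : U `<=` V) :
  smooth (fun x : U => exist _ (val x) (mem_set (UV _ (set_mem (valP x)))) : V).
Proof. by exists id => //; apply: smooth_on_id. Qed.

Definition smap_incl n (U V : domain n) (UV : U `<=` V) : smooth_map U V :=
  SmoothMap (smooth_incl UV).

Definition domainI n (U V : domain n) : domain n :=
  Domain (openI (domain_open U) (domain_open V)).

Lemma smap_inj n m (U : domain n) (V : domain m) (F G : smooth_map U V) :
  F = G :> (U -> V) -> F = G.
Proof.
by case: F G => [f pf] [g pg] /= E; subst g; congr SmoothMap; apply: Prop_irrelevance.
Qed.

End Domains.
Arguments domain R n : clear implicits.

Section Supremum.
Context {R : realType} {T : Type} {n : nat}.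

Definition compatible {I : Type} (U : I -> domain R n) (P : forall i, U i -> T) :=
  forall i j (x : U i) (y : U j), val x = val y -> P i x = P j y.

Record is_supremum {I : Type} (U : I -> domain R n) (P : forall i, U i -> T)
    (V : domain R n) (Q : V -> T) : Prop := IsSupremum {
  sup_compatible : compatible P ;
  sup_domain : V = \bigcup_i U i :> set _ ;
  sup_agree : forall i (x : U i) (y : V), val x = val y -> Q y = P i x }.
End Supremum.

Record diffeological_space (R : realType) := DiffeologicalSpace {
  carrier :> Type ;
  is_plot : forall n (U : domain R n), (U -> carrier) -> Prop ;
  plot_cover : forall x, exists n (U : domain R n) (P : U -> carrier),
    is_plot P /\ exists u, P u = x ;
  plot_comp : forall n m (U : domain R n) (V : domain R m)
    (P : V -> carrier) (F : smooth_map U V), is_plot P -> is_plot (P \o F) ;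
  plot_sup : forall n (I : Type) (U : I -> domain R n)
    (P : forall i, U i -> carrier) (V : domain R n) (Q : V -> carrier),
    (forall i, is_plot (P i)) -> is_supremum P Q -> is_plot Q }.

Section Plots.
Context {R : realType} (X : diffeological_space R).

Record plot := Plot {
  plot_dim : nat ;
  plot_dom : domain R plot_dim ;
  plot_fun :> plot_dom -> X ;
  plotP : is_plot plot_fun }.

Arguments plot_fun p : clear implicits.
Arguments plotP p : clear implicits.

(* A morphism of plots from [Q] to [P]. *)
Record plot_hom (Q P : plot) := Hom {
  hom_map :> smooth_map (plot_dom Q) (plot_dom P) ;
  homP : P \o hom_map = Q :> (plot_dom Q -> X) }.

Definition hom_id (P : plot) : plot_hom P P :=
  @Hom P P (smap_id (plot_dom P)) erefl.

Lemma hom_comp_subproof S Q P (F : plot_hom Q P) (G : plot_hom S Q) :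
  P \o smap_comp F G = S :> (plot_dom S -> X).
Proof. by rewrite -(homP G) -(homP F). Qed.

Definition hom_comp S Q P (F : plot_hom Q P) (G : plot_hom S Q) : plot_hom S P :=
  Hom (hom_comp_subproof F G).

Lemma hom_inj Q P (F G : plot_hom Q P) :
  F = G :> (plot_dom Q -> plot_dom P) -> F = G.
Proof.
case: F G => [f pf] [g pg] /= /smap_inj E; subst g.
by congr Hom; apply: Prop_irrelevance.
Qed.

(* The family of the parametrizations [P \o F] with [P] in [C], often written
   with floor brackets around [C]; [generated_plots C] is the same family seen as
   a set of plots. *)
Definition generated (C : set plot) n (U : domain R n) : set (U -> X) :=
  [set Q | exists2 P, C P & exists F : smooth_map U (plot_dom P), P \o F = Q].

Record is_covering_generating (C : set plot) : Prop := IsCoveringGenerating {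
  cg_cover : forall x : X, exists2 P, C P & exists u, P u = x ;
  cg_generate : forall P : plot,
    exists (I : Type) (U : I -> domain R (plot_dim P)) (Q : forall i, U i -> X),
      (forall i, generated C (Q i)) /\ is_supremum Q P }.

Record covering_generating_family := CGF {
  cgf_set :> set plot ;
  cgf_cg : is_covering_generating cgf_set }.

Definition generated_plots (C : set plot) : set plot :=
  [set Q | generated C (plot_fun Q)].

Lemma generated_is_plot C n (U : domain R n) (Q : U -> X) : generated C Q -> is_plot Q.
Proof. by move=> [P _ [F <-]]; apply/plot_comp/plotP. Qed.

Lemma generated_comp C n m (U : domain R n) (V : domain R m) (Q : V -> X)
  (F : smooth_map U V) : generated C Q -> generated C (Q \o F).
Proof. by move=> [P CP [G <-]]; exists P => //; exists (smap_comp G F). Qed.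

Lemma sub_generated C : C `<=` generated_plots C.
Proof. by move=> P CP; exists P => //; exists (smap_id _). Qed.

Lemma all_plots_cg : is_covering_generating setT.
Proof.
split=> [x|P].
  have [n [U [P [pP Px]]]] := plot_cover x.
  by exists (Plot pP).
exists unit, (fun=> plot_dom P), (fun=> plot_fun P); split.
  by move=> _; apply: sub_generated.
have agree (x y : plot_dom P) : val x = val y -> P x = P y by move=> /val_inj ->.
split=> [_ _ ? ?||_ x y /esym]; [exact: agree| |exact: agree].
by rewrite bigcup_const//; exists tt.
Qed.

Definition all_plots : covering_generating_family := CGF all_plots_cg.

Lemma generatedI_cg (C C' : covering_generating_family) :
  is_covering_generating (generated_plots C `&` generated_plots C').
Proof.
split=> [x|P].
  have [P CP [u Pu]] := cg_cover (cgf_cg C) x.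
  have [I [U [Q [C'Q [_ domP QP]]]]] := cg_generate (cgf_cg C') P.
  have := set_mem (valP u); rewrite [X in X _]domP => -[i _ Uiu].
  have UP : U i `<=` plot_dom P by move=> y Uy; rewrite domP; exists i.
  pose v : U i := exist _ (val u) (mem_set Uiu).
  have QE : P \o smap_incl UP = Q i by apply/funext => w /=; apply: QP.
  exists (Plot (generated_is_plot (C'Q i))); last by exists v; rewrite /= -Pu; apply/esym/QP.
  split; last exact: C'Q.
  by exists P => //; exists (smap_incl UP).
have [I [U [Q [CQ [coQ domQ QP]]]]] := cg_generate (cgf_cg C) P.
have [J [V [Q' [CQ' [coQ' domQ' QP']]]]] := cg_generate (cgf_cg C') P.
have sub1 k : domainI (U k.1) (V k.2) `<=` U k.1 by move=> ? [].
have sub2 k : domainI (U k.1) (V k.2) `<=` V k.2 by move=> ? [].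
pose W (k : I * J) := domainI (U k.1) (V k.2).
have subP k : W k `<=` plot_dom P.
  by move=> y /sub1 Uy; rewrite domQ; exists k.1.
have QE k : P \o smap_incl (subP k) = Q k.1 \o smap_incl (sub1 k).
  by apply/funext => w /=; apply: QP.
have QE' k : P \o smap_incl (subP k) = Q' k.2 \o smap_incl (sub2 k).
  by apply/funext => w /=; apply: QP'.
exists (I * J)%type, W, (fun k => P \o smap_incl (subP k)); split.
  move=> k; have pk := plot_comp (smap_incl (subP k)) (plotP P).
  apply: (@sub_generated _ (Plot pk)); split; rewrite /generated_plots /=.
    by rewrite QE; apply: generated_comp.
  by rewrite QE'; apply: generated_comp.
split.
- by move=> k l x y xy /=; congr (P _); apply: val_inj.
- apply/seteqP; split=> y; last by move=> [k _]; apply: subP.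
  move=> Py; have := Py; rewrite {1}domQ => -[i _ Uy].
  by move: Py; rewrite domQ' => -[j _ Vy]; exists (i, j).
- by move=> k x y xy; congr (P _); apply: val_inj.
Qed.

End Plots.
Arguments covering_generating_family {R} X.

(* The direct product of a family of abelian groups. *)
Section DProd.
Variables (I : Type) (T : I -> zmodType).
Definition dprod : Type := forall i, T i.
HB.instance Definition _ := gen_eqMixin dprod.
HB.instance Definition _ := gen_choiceMixin dprod.

Fact dprod_addA : associative (fun (f g : dprod) i => f i + g i).
Proof. by move=> f g h; apply: functional_extensionality_dep => i; rewrite addrA. Qed.
Fact dprod_addC : commutative (fun (f g : dprod) i => f i + g i).
Proof. by move=> f g; apply: functional_extensionality_dep => i; rewrite addrC. Qed.
Fact dprod_add0 : left_id ((fun=> 0) : dprod) (fun (f g : dprod) i => f i + g i).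
Proof. by move=> f; apply: functional_extensionality_dep => i; rewrite add0r. Qed.
Fact dprod_addN : left_inverse ((fun=> 0) : dprod) (fun (f : dprod) i => - f i)
  (fun (f g : dprod) i => f i + g i).
Proof. by move=> f; apply: functional_extensionality_dep => i; rewrite addNr. Qed.
HB.instance Definition _ := GRing.isZmodule.Build dprod
  dprod_addA dprod_addC dprod_add0 dprod_addN.
End DProd.

Section Ker.
Variables (U V : zmodType) (f : {additive U -> V}).
Definition ker_pred : {pred U} := fun x => f x == 0.
Fact ker_zmod_closed : zmod_closed ker_pred.
Proof.
split=> [|x y]; first by rewrite unfold_in /ker_pred raddf0.
by rewrite !unfold_in /ker_pred raddfB => /eqP -> /eqP ->; rewrite subr0.
Qed.
Record additive_ker := Ker { ker_val : U ; kerP : ker_val \in ker_pred }.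
HB.instance Definition _ := [isSub of additive_ker for ker_val].
HB.instance Definition _ := [Choice of additive_ker by <:].
HB.instance Definition _ := GRing.isZmodClosed.Build U ker_pred ker_zmod_closed.
HB.instance Definition _ := [SubChoice_isSubZmodule of additive_ker by <:].
End Ker.

Lemma kerE (U V : zmodType) (f : {additive U -> V}) (x : additive_ker f) :
  f (ker_val x) = 0.
Proof. exact/eqP/(kerP x). Qed.

Section Presheaf.
Context {R : realType} (X : diffeological_space R).

Record presheaf := Presheaf {
  psh_obj :> plot X -> zmodType ;
  psh_res : forall Q P : plot X, plot_hom Q P -> {additive psh_obj P -> psh_obj Q} ;
  psh_res_id : forall (P : plot X) (a : psh_obj P), psh_res (hom_id P) a = a ;
  psh_res_comp : forall (S Q P : plot X) (F : plot_hom Q P) (G : plot_hom S Q)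
    (a : psh_obj P),
    psh_res (hom_comp F G) a = psh_res G (psh_res F a) }.

End Presheaf.
Arguments psh_res {R X} A {Q P} F : rename.

(* The limit of [A] over the full subcategory of plots whose objects are the
   [p i]. *)
Section Limit.
Context {R : realType} {X : diffeological_space R} (A : presheaf X).
Context {I : Type} (p : I -> plot X).

Definition is_section (s : dprod (fun i => A (p i))) : Prop :=
  forall (i j : I) (F : plot_hom (p i) (p j)), psh_res A F (s j) = s i.

Definition section_pred : {pred dprod (fun i => A (p i))} :=
  fun s => `[< is_section s >].

Fact section_zmod_closed : zmod_closed section_pred.
Proof.
split=> [|s t]; first by apply/asboolP => i j F; rewrite raddf0.
move=> /asboolP ss /asboolP st; apply/asboolP => i j F.
by rewrite [LHS]raddfB ss st.
Qed.

Record sections := Sections {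
  section_val : dprod (fun i => A (p i)) ;
  sectionP : section_val \in section_pred }.
HB.instance Definition _ := [isSub of sections for section_val].
HB.instance Definition _ := [Choice of sections by <:].
HB.instance Definition _ :=
  GRing.isZmodClosed.Build _ section_pred section_zmod_closed.
HB.instance Definition _ := [SubChoice_isSubZmodule of sections by <:].

Lemma sectionE (s : sections) (i j : I) (F : plot_hom (p i) (p j)) :
  psh_res A F (section_val s j) = section_val s i.
Proof. exact: (asboolW (sectionP s)). Qed.
End Limit.
Arguments is_section {R X} A {I} p s.
Arguments section_pred {R X} A {I} p s.
Arguments sections {R X} A {I} p.

Section Cech.
Context {R : realType} {X : diffeological_space R} (A : presheaf X).
Implicit Types C D : covering_generating_family X.

(* Global sections: the limit over all plots. *)
Definition Sigma : zmodType := sections A (@id (plot X)).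
Definition SigmaC C : zmodType :=
  sections A (val : generated_plots C -> plot X).

Section alpha.
Variable C : covering_generating_family X.
Fact alpha_subproof (s : Sigma) :
  (fun P => section_val s (val P)) \in section_pred A (val : generated_plots C -> plot X).
Proof. by apply/asboolP => P Q F; apply: (sectionE (p := id)). Qed.
Definition alpha (s : Sigma) : SigmaC C := Sections (alpha_subproof s).
Fact alpha_additive : zmod_morphism alpha.
Proof. by move=> s t; apply: val_inj. Qed.
HB.instance Definition _ := GRing.isZmodMorphism.Build Sigma (SigmaC C) alpha
  alpha_additive.
End alpha.

Definition C0 C : zmodType := @dprod C (fun P => A (val P)).

(* The diagram  P_0 <-F_1- Q -F_0-> P_1, where [face1] is F_1 and [face0] is
   F_0. *)
Record simplex1 C := Simplex1 {
  vertex0 : C ;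
  vertex1 : C ;
  nerve : plot X ;
  face1 : plot_hom nerve (val vertex0) ;
  face0 : plot_hom nerve (val vertex1) }.

Definition C1 C : zmodType :=
  @dprod (simplex1 C) (fun s => A (nerve s)).

Definition delta0 C (c : C0 C) : C1 C :=
  fun s => psh_res A (face0 s) (c (vertex1 s)) - psh_res A (face1 s) (c (vertex0 s)).
Fact delta0_additive C : zmod_morphism (@delta0 C).
Proof.
move=> c d; apply: functional_extensionality_dep => s.
have subE P : (c - d) P = c P - d P by [].
have -> : (delta0 c - delta0 d) s = delta0 c s - delta0 d s by [].
by rewrite /delta0 !subE !raddfB addrACA.
Qed.
HB.instance Definition _ C := GRing.isZmodMorphism.Build (C0 C) (C1 C) (@delta0 C)
  (@delta0_additive C).

Definition H0 C : zmodType := additive_ker (@delta0 C).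

Section beta.
Variable C : covering_generating_family X.
Definition in_generated (P : C) : generated_plots C :=
  exist _ (val P) (mem_set (sub_generated (set_mem (valP P)))).
Definition beta_val (s : SigmaC C) : C0 C := fun P => section_val s (in_generated P).

Fact beta_subproof (s : SigmaC C) : beta_val s \in ker_pred (@delta0 C).
Proof.
apply/eqP; apply: functional_extensionality_dep => t.
have nt : nerve t \in generated_plots C.
  apply/mem_set; exists (val (vertex0 t)); first exact: set_mem (valP _).
  by exists (face1 t); apply: homP.
pose N : generated_plots C := exist _ (nerve t) nt.
apply/eqP; rewrite subr_eq0; apply/eqP.
transitivity (section_val s N); last apply/esym.
  exact: (@sectionE _ _ A _ _ s N (in_generated (vertex1 t)) (face0 t)).
exact: (@sectionE _ _ A _ _ s N (in_generated (vertex0 t)) (face1 t)).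
Qed.
Definition beta (s : SigmaC C) : H0 C := Ker (beta_subproof s).
Fact beta_additive : zmod_morphism beta.
Proof. by move=> s t; apply: val_inj. Qed.
HB.instance Definition _ := GRing.isZmodMorphism.Build (SigmaC C) (H0 C) beta
  beta_additive.
End beta.

Lemma H0E C (c : H0 C) (s : simplex1 C) :
  psh_res A (face0 s) (ker_val c (vertex1 s)) = psh_res A (face1 s) (ker_val c (vertex0 s)).
Proof. by apply/eqP; rewrite -subr_eq0; apply/eqP; exact: (congr1 (@^~ s) (kerE c)). Qed.

(* [refinement C' C]: the data making [C'] a refinement of [C]. *)
Record refinement C' C := Refinement {
  ref_index : C' -> C ;
  ref_map : forall P : C', plot_hom (val P) (val (ref_index P)) }.

Section refine.
Variables (C' C : covering_generating_family X) (r : refinement C' C).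

Definition refine_val (c : H0 C) : C0 C' :=
  fun P => psh_res A (ref_map r P) (ker_val c (ref_index r P)).
Fact refine_subproof (c : H0 C) : refine_val c \in ker_pred (@delta0 C').
Proof.
apply/eqP; apply: functional_extensionality_dep => t.
apply/eqP; rewrite subr_eq0; apply/eqP; rewrite /refine_val -!psh_res_comp.
exact: (H0E c (Simplex1 (hom_comp (ref_map r (vertex0 t)) (face1 t))
                        (hom_comp (ref_map r (vertex1 t)) (face0 t)))).
Qed.
Definition refine (c : H0 C) : H0 C' := Ker (refine_subproof c).
Fact refine_additive : zmod_morphism refine.
Proof.
move=> s t; apply: val_inj; apply: functional_extensionality_dep => P.
exact: raddfB.
Qed.
HB.instance Definition _ := GRing.isZmodMorphism.Build (H0 C) (H0 C') refine
  refine_additive.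
End refine.

Lemma refine_unique C' C (r r' : refinement C' C) (c : H0 C) :
  refine r c = refine r' c.
Proof.
apply: val_inj; apply: functional_extensionality_dep => P.
exact: (H0E c (Simplex1 (ref_map r' P) (ref_map r P))).
Qed.

Definition ref_id C : refinement C C :=
  @Refinement C C id (fun P => hom_id (val P)).
Lemma refine_id C (c : H0 C) : refine (ref_id C) c = c.
Proof. by apply: val_inj; apply: functional_extensionality_dep => P; exact: psh_res_id. Qed.

Definition ref_comp C'' C' C (r : refinement C' C)
    (s : refinement C'' C') : refinement C'' C :=
  @Refinement C'' C (ref_index r \o ref_index s)
    (fun P => hom_comp (ref_map r (ref_index s P)) (ref_map s P)).
Lemma refine_comp C'' C' C (r : refinement C' C) (s : refinement C'' C')
    (c : H0 C) :
  refine (ref_comp r s) c = refine s (refine r c).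
Proof. by apply: val_inj; apply: functional_extensionality_dep => P; exact: psh_res_comp. Qed.

Lemma ref_of_generated C' C :
  C' `<=` generated_plots C -> inhabited (refinement C' C).
Proof.
move=> sub.
have /choice [f fP] (P : C') : exists Q : C, inhabited (plot_hom (val P) (val Q)).
  have [Q CQ [F QF]] := sub _ (set_mem (valP P)).
  by exists (exist _ Q (mem_set CQ)); exists; exact: (@Hom _ _ _ Q F QF).
have F P : plot_hom (val P) (val (f P)) by apply: (inhabited_witness (fP P)).
by exists; exists f.
Qed.

Lemma common_refinement C C' :
  exists D : covering_generating_family X, inhabited (refinement D C * refinement D C').
Proof.
exists (CGF (generatedI_cg C C')).
have [r] : inhabited (refinement (CGF (generatedI_cg C C')) C) by apply: ref_of_generated => P [].
have [r'] : inhabited (refinement (CGF (generatedI_cg C C')) C') by apply: ref_of_generated => P [].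
by exists.
Qed.

(* The colimit of the groups [H0 C]. Covering generating families and
   refinements form a directed system: parallel refinements induce the same map
   ([refine_unique]) and common refinements exist ([common_refinement]). The
   colimit is thus the disjoint union of the [H0 C] modulo equality after
   restriction to some common refinement. *)
Definition germ : Type := {C : covering_generating_family X & H0 C}.
HB.instance Definition _ := gen_eqMixin germ.
HB.instance Definition _ := gen_choiceMixin germ.

Definition germ_rel (x y : germ) : bool :=
  `[< exists D (r : refinement D (tag x)) (r' : refinement D (tag y)),
      refine r (tagged x) = refine r' (tagged y) >].

Fact germ_rel_equiv : equiv_class_of germ_rel.
Proof.
split=> [x|x y|y x z].
- by apply/asboolP; exists (tag x), (ref_id _), (ref_id _).
- by apply/asboolP/asboolP => -[D [r [r' E]]]; exists D, r', r.
- move=> /asboolP [D [r [s E]]] /asboolP [D' [s' [t E']]]; apply/asboolP.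
  have [B [[u u']]] := common_refinement D D'.
  exists B, (ref_comp r u), (ref_comp t u').
  by rewrite !refine_comp E -E' -!refine_comp; apply: refine_unique.
Qed.
Canonical germ_equiv := EquivRelPack germ_rel_equiv.

Definition cech_H0 : Type := {eq_quot germ_equiv}.
HB.instance Definition _ := Choice.on cech_H0.
HB.instance Definition _ := EqQuotient.on cech_H0.

Definition gamma C (c : H0 C) : cech_H0 :=
  \pi_cech_H0 (Tagged H0 c).

Lemma gamma_eq C C' (c : H0 C) (c' : H0 C') :
  gamma c = gamma c' <->
  exists D (r : refinement D C) (r' : refinement D C'),
    refine r c = refine r' c'.
Proof.
split=> [/eqmodP/asboolP //|E].
by apply/eqmodP/asboolP.
Qed.

Lemma gamma_refine C' C (r : refinement C' C) (c : H0 C) :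
  gamma (refine r c) = gamma c.
Proof.
by apply/gamma_eq; exists C', (ref_id C'), r; rewrite refine_id.
Qed.

Lemma gamma_surj (x : cech_H0) : exists C (c : H0 C), x = gamma c.
Proof. by elim/quotW: x => -[C c]; exists C, c. Qed.

Lemma gamma_repr2 (x y : cech_H0) :
  exists t : {C : covering_generating_family X & (H0 C * H0 C)%type},
  x = gamma (tagged t).1 /\ y = gamma (tagged t).2.
Proof.
have [C [c ->]] := gamma_surj x; have [C' [c' ->]] := gamma_surj y.
have [D [[r r']]] := common_refinement C C'.
by exists (existT _ D (refine r c, refine r' c')); rewrite /= !gamma_refine.
Qed.

Definition cech_add (x y : cech_H0) : cech_H0 :=
  let t := sval (cid (gamma_repr2 x y)) in gamma ((tagged t).1 + (tagged t).2).
Definition cech_opp (x : cech_H0) : cech_H0 := gamma (- tagged (repr x)).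
Definition cech_zero : cech_H0 := gamma (0 : H0 (all_plots X)).

Lemma gamma_congD C C' (c d : H0 C) (c' d' : H0 C') :
  gamma c = gamma c' -> gamma d = gamma d' -> gamma (c + d) = gamma (c' + d').
Proof.
move=> /gamma_eq [D [r [s E]]] /gamma_eq [D' [r' [s' E']]].
have [B [[u u']]] := common_refinement D D'.
rewrite -(gamma_refine (ref_comp r u)) -(gamma_refine (ref_comp s u)) !raddfD /=.
congr (gamma (_ + _)); first by rewrite !refine_comp E.
rewrite (refine_unique _ (ref_comp r' u')) (refine_unique _ (ref_comp s' u')).
by rewrite !refine_comp E'.
Qed.

Lemma gammaD C (c d : H0 C) : cech_add (gamma c) (gamma d) = gamma (c + d).
Proof.
rewrite /cech_add; case: cid => -[D [a b]] /= [E E'].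
exact: gamma_congD (esym E) (esym E').
Qed.

Lemma gamma0 C : gamma (0 : H0 C) = cech_zero.
Proof.
have [D [[r r']]] := common_refinement C (all_plots X).
by rewrite -(gamma_refine r) /cech_zero -(gamma_refine r') !raddf0.
Qed.

Lemma gammaN C (c : H0 C) : cech_opp (gamma c) = gamma (- c).
Proof.
rewrite /cech_opp; case: (repr _) (reprK (gamma c)) => D d /gamma_eq.
move=> [B [r [r' E]]]; rewrite -(gamma_refine r) -(gamma_refine r') !raddfN /=.
by rewrite E.
Qed.

Fact cech_addC : commutative cech_add.
Proof. by move=> x y; have [[C [c d]] [-> ->]] := gamma_repr2 x y; rewrite !gammaD addrC. Qed.
Fact cech_add0 : left_id cech_zero cech_add.
Proof. by move=> x; have [C [c ->]] := gamma_surj x; rewrite -(gamma0 C) gammaD add0r. Qed.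
Fact cech_addN : left_inverse cech_zero cech_opp cech_add.
Proof. by move=> x; have [C [c ->]] := gamma_surj x; rewrite gammaN gammaD addNr gamma0. Qed.
Fact cech_addA : associative cech_add.
Proof.
move=> x y z; have [[C [c d]] [-> ->]] := gamma_repr2 x y; have [C' [e ->]] := gamma_surj z.
have [D [[r r']]] := common_refinement C C'.
rewrite /= -(gamma_refine r c) -(gamma_refine r d) -(gamma_refine r' e).
by rewrite !gammaD addrA.
Qed.
HB.instance Definition _ := GRing.isZmodule.Build cech_H0
  cech_addA cech_addC cech_add0 cech_addN.

Fact gamma_additive C : zmod_morphism (@gamma C).
Proof.
move=> c d; transitivity (cech_add (gamma c) (cech_opp (gamma d))) => //.
by rewrite gammaN gammaD.
Qed.
HB.instance Definition _ C :=
  GRing.isZmodMorphism.Build (H0 C) cech_H0 (@gamma C) (@gamma_additive C).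

Definition zmod_isomorphism (U V : zmodType) (f : {additive U -> V}) : Prop :=
  exists g : {additive V -> U}, cancel f g /\ cancel g f.

Definition quasi_sheaf : Prop := forall C, zmod_isomorphism (alpha C).

Definition cech_hom C : {additive Sigma -> cech_H0} :=
  @gamma C \o @beta C \o alpha C.

End Cech.

(* Main.v *)
From HB Require Import structures.
Require Import Defs.
From mathcomp Require Import all_boot all_order all_algebra.
From mathcomp Require Import all_classical reals.

(** Over every covering generating family [C], the map [beta C \o alpha C]
    restricts a global section [s] to its values on the members of [C]. For a
    quasi-sheaf it is bijective: [alpha C] is so by definition, and [beta C] is
    so for any presheaf, because a section over the plots [P \o F] with [P] in
    [C] is determined by its values on [C], while a 0-cocycle [c] extends to
    such a section by the formula [F^* c(P)] ([beta_inj], [beta_surj]). The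
    cocycle condition says precisely that this value depends only on the plot
    [P \o F] and not on the chosen factorization ([cocycle_coherent]).

    Moreover these restrictions are compatible with the refinement maps
    ([refine_restriction]), since a section is invariant under pullback along
    any morphism of plots. Hence the [H0 C] form a directed system in which
    every group is identified with the global sections and every transition
    map with the identity, so the colimit is again the group of global
    sections, through any of the maps [cech_hom A C]. Concretely, a global
    section killed in the colimit is killed over some refinement, and is thus
    zero; a class in the colimit is represented by a cocycle over some [D],
    which is the restriction of a global section, and the image of that section
    in the colimit may as well be computed over [C] ([cech_hom_indep]). *)

Set Implicit Arguments.
Unset Strict Implicit.
Unset Printing Implicit Defensive.

Import GRing.Theory.

Local Open Scope classical_set_scope.
Local Open Scope ring_scope.

Lemma zmod_isomorphism_inj (U V : zmodType) (f : {additive U -> V}) :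
  zmod_isomorphism f -> injective f.
Proof. by move=> [g [fK _]]; apply: can_inj fK. Qed.

Lemma zmod_isomorphism_surj (U V : zmodType) (f : {additive U -> V}) (y : V) :
  zmod_isomorphism f -> exists x, f x = y.
Proof. by move=> [g [_ gK]]; exists (g y). Qed.

Lemma bij_zmod_isomorphism (U V : zmodType) (f : {additive U -> V}) :
  injective f -> (forall y, exists x, f x = y) -> zmod_isomorphism f.
Proof.
move=> f_inj /choice [g gK]; have fK : cancel f g by move=> x; apply/f_inj/gK.
pose gM := GRing.isZmodMorphism.Build V U g (can2_zmod_morphism fK gK).
by exists (HB.pack_for {additive V -> U} g gM).
Qed.

Section Restriction.
Context {R : realType} {X : diffeological_space R} (A : presheaf X).
Implicit Types C D : covering_generating_family X.

(** Two factorizations of the same plot through members of [C] are exactly the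
    two faces of a 1-simplex. *)
Lemma cocycle_coherent C (c : H0 A C) (Q : plot X) (P P' : C)
    (F : plot_hom Q (val P)) (F' : plot_hom Q (val P')) :
  psh_res A F (ker_val c P) = psh_res A F' (ker_val c P').
Proof. exact: (H0E c (Simplex1 F' F)). Qed.

Lemma generated_factor C (Q : generated_plots C) :
  exists P : C, inhabited (plot_hom (val Q) (val P)).
Proof.
have [P CP [F PF]] := set_mem (valP Q).
exists (exist _ P (mem_set CP)); exact: inhabits (Defs.Hom PF).
Qed.

(** The values on [C] determine a section, because every plot of its domain is
    the source of a morphism to a member of [C]. *)
Lemma beta_inj C : injective (@beta _ _ A C).
Proof.
move=> s t st; apply: val_inj; apply: functional_extensionality_dep => Q.
have [P [F]] := generated_factor Q.
have E : section_val s (in_generated P) = section_val t (in_generated P).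
  exact: (congr1 (fun c : H0 A C => ker_val c P) st).
rewrite -[LHS](@sectionE _ _ A _ _ s Q (in_generated P) F) E.
exact: (@sectionE _ _ A _ _ t Q (in_generated P) F).
Qed.

(** The extension of [c] is [F^* c(P)] for an arbitrary choice of a
    factorization [P \o F] of each generated plot; coherence gives both its
    invariance under pullback and the fact that it restricts to [c], even though
    the factorization chosen for a member of [C] need not be the identity. *)
Lemma beta_surj C (c : H0 A C) : exists s, beta s = c.
Proof.
have /choice [f /= fP] := @generated_factor C.
have F Q : plot_hom (val Q) (val (f Q)) by apply: (inhabited_witness (fP Q)).
pose s (Q : generated_plots C) := psh_res A (F Q) (ker_val c (f Q)).
have sP : s \in section_pred A (val : generated_plots C -> plot X).
  apply/asboolP => Q Q' G; rewrite /s -psh_res_comp; exact: cocycle_coherent.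
exists (Sections sP); apply: val_inj; apply: functional_extensionality_dep => P.
rewrite -[RHS](psh_res_id (p := A)).
exact: (cocycle_coherent c (F (in_generated P)) (hom_id (val P))).
Qed.

(** A section is invariant under the pullbacks along the morphisms of plots that
    make up the refinement. *)
Lemma refine_restriction C D (r : refinement D C) (s : Sigma A) :
  refine r (beta (alpha C s)) = beta (alpha D s).
Proof.
apply: val_inj; apply: functional_extensionality_dep => P.
exact: (sectionE (p := id) s (ref_map r P)).
Qed.

Lemma cech_hom_indep C D (s : Sigma A) : cech_hom A C s = cech_hom A D s.
Proof.
have [B [[r r']]] := common_refinement C D.
by apply/gamma_eq; exists B, r, r'; rewrite !refine_restriction.
Qed.

End Restriction.

Theorem proposition4p6 (R : realType) (X : diffeological_space R)
    (A : presheaf X) (hA : quasi_sheaf A) (C : covering_generating_family X) :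
  zmod_isomorphism (cech_hom A C).
Proof.
apply: bij_zmod_isomorphism => [s t /gamma_eq [D [r [r' E]]]|x].
  apply: (zmod_isomorphism_inj (hA D)); apply: beta_inj.
  by move: E; rewrite /= !refine_restriction.
have [D [c ->]] := gamma_surj x; have [t <-] := beta_surj c.
have [s <-] := zmod_isomorphism_surj t (hA D).
by exists s; rewrite (cech_hom_indep C D).
Qed.
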